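(* Let $\mathbb{GA}_N$ be an $N$-dimensional manifold with a non-symmetric affine connection with coefficients $L^i_{jk}$, and let $a^i_j$ be a tensor of type $(1,1)$. Three of the five covariant derivatives $a^i_{j|k}$, $a^i_{j\underset{1}{|}k}$, $a^i_{j\underset{2}{|}k}$, $a^i_{j\underset{3}{|}k}$, $a^i_{j\underset{4}{|}k}$ are linearly independent; that is, among these five there are three which are linearly independent and whose linear combinations express the remaining two.
   Context: The coefficients $L^i_{jk}$ are in general not symmetric in $j,k$. Put $L^i_{\underline{jk}}=\frac12(L^i_{jk}+L^i_{kj})$. A comma denotes a partial derivative and repeated Greek indices are summed. The five kinds of covariant derivative of a $(1,1)$ tensor $a^i_j$ are $$a^i_{j|k}=a^i_{j,k}+L^i_{\underline{\alpha k}}a^\alpha_j-L^\alpha_{\underline{jk}}a^i_\alpha,$$ $$a^i_{j\underset{1}{|}k}=a^i_{j,k}+L^i_{\alpha k}a^\alpha_j-L^\alpha_{jk}a^i_\alpha,\qquad a^i_{j\underset{2}{|}k}=a^i_{j,k}+L^i_{k\alpha}a^\alpha_j-L^\alpha_{kj}a^i_\alpha,$$ $$a^i_{j\underset{3}{|}k}=a^i_{j,k}+L^i_{\alpha k}a^\alpha_j-L^\alpha_{kj}a^i_\alpha,\qquad a^i_{j\underset{4}{|}k}=a^i_{j,k}+L^i_{k\alpha}a^\alpha_j-L^\alpha_{jk}a^i_\alpha.$$ Linear combinations have real constant coefficients. The covariant derivatives are treated as vectors whose components are the summands on the right-hand sides, i.e. as formal expressions in the generically independent terms $a^i_{j,k}$,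 $L^i_{\alpha k}a^\alpha_j$, $L^i_{k\alpha}a^\alpha_j$, $L^\alpha_{jk}a^i_\alpha$, $L^\alpha_{kj}a^i_\alpha$ (for arbitrary $L$ and $a$); linear independence is understood in this sense. *)

(* Defs.v *)
From HB Require Import structures.
From mathcomp Require Import all_boot all_order all_algebra.
From mathcomp Require Import all_classical all_reals all_analysis.
Set Implicit Arguments.
Unset Strict Implicit.
Unset Printing Implicit Defensive.
Import Order.TTheory GRing.Theory Num.Theory.
Import numFieldNormedType.Exports.
Local Open Scope classical_set_scope.
Local Open Scope ring_scope.

Section Calculus.
Variables (R : realType) (N : nat).

Definition partial (k : 'I_N) (f : 'rV[R]_N -> R) (x : 'rV[R]_N) : R :=
  'D_(delta_mx 0 k) f x.

Fixpoint Ck (n : nat) (U : set 'rV[R]_N) (f : 'rV[R]_N -> R) : Prop :=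
  {within U, continuous f} /\
  if n is n'.+1 then
    forall k : 'I_N,
      (forall x, U x -> derivable f x (delta_mx 0 k)) /\ Ck n' U (partial k f)
  else True.

Definition smooth (U : set 'rV[R]_N) (f : 'rV[R]_N -> R) : Prop :=
  forall n, Ck n U f.

End Calculus.

(* Manifolds are given by a smooth atlas.  [param u] is the inverse of the
   coordinate map [local_coord u]; outside [dom u], resp. [local_coord u @` dom u],
   the two (total) functions are irrelevant. *)
Record manifold (R : realType) (N : nat) := Manifold {
  space :> topologicalType;
  space_hausdorff : hausdorff_space space;
  space_countable : @second_countable space;
  chart : Type;
  dom : chart -> set space;
  local_coord : chart -> space -> 'rV[R]_N;
  param : chart -> 'rV[R]_N -> space;
  dom_open : forall u, open (dom u);
  dom_cover : forall p, exists u, dom u p;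
  image_open : forall u, open (local_coord u @` dom u);
  coordK : forall u p, dom u p -> param u (local_coord u p) = p;
  coord_continuous : forall u, {within dom u, continuous (local_coord u)};
  param_continuous : forall u,
    {within local_coord u @` dom u, continuous (param u)};
  transition_smooth : forall u v (i : 'I_N),
    smooth (local_coord u @` (dom u `&` dom v))
      (fun x => local_coord v (param u x) 0 i)
}.

Section Fields.
Variables (R : realType) (N : nat) (M : manifold R N).

(* the [i]-th coordinate of chart [v] as a function of the coordinates of [u] *)
Definition transition (u v : chart M) (i : 'I_N) (x : 'rV[R]_N) : R :=
  local_coord v (param u x) 0 i.

(* [coef u i j k] is L^i_jk in the chart [u]; no symmetry in j, k is required. *)
Record connection := Connection {
  coef : chart M -> 'I_N -> 'I_N -> 'I_N -> 'rV[R]_N -> R;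
  coef_smooth : forall u i j k, smooth (local_coord u @` dom u) (coef u i j k);
  coef_transform : forall u v p, dom u p -> dom v p -> forall i j k,
    coef v i j k (local_coord v p) =
    \sum_al partial al (transition u v i) (local_coord u p) *
      (\sum_be \sum_ga
         partial j (transition v u be) (local_coord v p) *
         partial k (transition v u ga) (local_coord v p) *
         coef u al be ga (local_coord u p)
       + partial k (partial j (transition v u al)) (local_coord v p))
}.

(* [component u i j] is a^i_j in the chart [u]. *)
Record tensor11 := Tensor11 {
  component : chart M -> 'I_N -> 'I_N -> 'rV[R]_N -> R;
  comp_smooth : forall u i j, smooth (local_coord u @` dom u) (component u i j);
  comp_transform : forall u v p, dom u p -> dom v p -> forall i j,
    component v i j (local_coord v p) =
    \sum_al \sum_be partial al (transition u v i) (local_coord u p) *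
      partial j (transition v u be) (local_coord v p) *
      component u al be (local_coord u p)
}.

End Fields.

Section CovariantDerivatives.
Variables (R : realType) (N : nat).

(* [L i j k] is L^i_jk, [a i j] is a^i_j and [da i j k] is a^i_{j,k}, all at one
   point. *)
Variables (L : 'I_N -> 'I_N -> 'I_N -> R) (a : 'I_N -> 'I_N -> R).
Variable da : 'I_N -> 'I_N -> 'I_N -> R.

Definition symL (i j k : 'I_N) : R := 2^-1 * (L i j k + L i k j).

(* Kind 0 is the derivative with respect to the symmetrized coefficients. *)
Definition covd (c : 'I_5) (i j k : 'I_N) : R :=
  match val c with
  | 0%N => da i j k + \sum_al symL i al k * a al j - \sum_al symL al j k * a i al
  | 1%N => da i j k + \sum_al L i al k * a al j - \sum_al L al j k * a i al
  | 2%N => da i j k + \sum_al L i k al * a al j - \sum_al L al k j * a i al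
  | 3%N => da i j k + \sum_al L i al k * a al j - \sum_al L al k j * a i al
  | _   => da i j k + \sum_al L i k al * a al j - \sum_al L al j k * a i al
  end.

Definition summand (t : 'I_5) (i j k : 'I_N) : R :=
  match val t with
  | 0%N => da i j k
  | 1%N => \sum_al L i al k * a al j
  | 2%N => \sum_al L i k al * a al j
  | 3%N => \sum_al L al j k * a i al
  | _   => \sum_al L al k j * a i al
  end.

(* A formal expression is the vector of its coefficients on the five terms
   [summand 0], ..., [summand 4]. *)
Definition expr_eval (e : 'rV[R]_5) (i j k : 'I_N) : R :=
  \sum_t e 0 t * summand t i j k.

End CovariantDerivatives.

Definition covd_expr (R : realType) (c : 'I_5) : 'rV[R]_5 :=
  \row_t nth 0 (match val c with
                | 0%N => [:: 1; 2^-1; 2^-1; - 2^-1; - 2^-1]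
                | 1%N => [:: 1; 1; 0; -1; 0]
                | 2%N => [:: 1; 0; 1; 0; -1]
                | 3%N => [:: 1; 1; 0; 0; -1]
                | _   => [:: 1; 0; 1; -1; 0]
                end) t.

Lemma expr_evalE (R : realType) (N : nat) L a da (e : 'rV[R]_5) (i j k : 'I_N) :
  expr_eval L a da e i j k =
  e 0 0 * da i j k
  + e 0 (inord 1) * (\sum_al L i al k * a al j)
  + e 0 (inord 2) * (\sum_al L i k al * a al j)
  + e 0 (inord 3) * (\sum_al L al j k * a i al)
  + e 0 (inord 4) * (\sum_al L al k j * a i al).
Proof.
rewrite /expr_eval !big_ord_recr big_ord0 [LHS]/=.
rewrite [X in X + _ + _ + _ + _]add0r /summand /=.
by do ![congr (_ + _)]; congr (e 0 _ * _); apply: val_inj; rewrite /= ?inordK.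
Qed.

Lemma covd_exprE (R : realType) (N : nat) L a da (c : 'I_5) (i j k : 'I_N) :
  covd L a da c i j k = expr_eval L a da (covd_expr R c) i j k.
Proof.
have sym1 : \sum_al symL L i al k * a al j =
    2^-1 * (\sum_al L i al k * a al j) + 2^-1 * (\sum_al L i k al * a al j).
  rewrite !mulr_sumr -big_split; apply: eq_bigr => al _.
  by rewrite /symL -mulrA mulrDl mulrDr.
have sym2 : \sum_al symL L al j k * a i al =
    2^-1 * (\sum_al L al j k * a i al) + 2^-1 * (\sum_al L al k j * a i al).
  rewrite !mulr_sumr -big_split; apply: eq_bigr => al _.
  by rewrite /symL -mulrA mulrDl mulrDr.
rewrite expr_evalE /covd_expr !mxE !inordK //.
case: c => -[|[|[|[|[|//]]]]] lt_c5; rewrite /covd /= ?sym1 ?sym2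
  ?mul1r ?mul0r ?addr0 ?mulN1r ?mulNr ?opprD ?addrA //.
Qed.

(* Generic independence of the five terms, which justifies working with formal
   expressions; it needs N >= 2, as for N = 1 all five derivatives have the same
   value. *)
Lemma expr_eval_inj (R : realType) (N : nat) (e : 'rV[R]_5) :
  (2 <= N)%N ->
  (forall L a da (i j k : 'I_N), expr_eval L a da e i j k = 0) -> e = 0.
Proof.
move=> N2 e0.
pose q : 'I_N := Ordinal (ltnW N2); pose p : 'I_N := Ordinal N2.
have pq : p == q = false by [].
have qp : q == p = false by [].
pose a0 (i j : 'I_N) : R := ((i == p) && (j == q))%:R.
pose L0 (s t : 'I_N) (i j k : 'I_N) : R := [&& i == q, j == s & k == t]%:R.
have sumL (f g : 'I_N -> R) r : (forall al, al != r -> f al * g al = 0) ->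
    \sum_al f al * g al = f r * g r.
  by move=> fg; rewrite (bigD1 r) //= big1 ?addr0.
have E0 : e 0 0 = 0.
  have := e0 (fun _ _ _ => 0) (fun _ _ => 0) (fun _ _ _ => 1) p p p.
  rewrite expr_evalE mulr1 !big1 ?mulr0 ?addr0 // => al _; exact: mulr0.
have key s t i j k : e 0 (inord 1) * (L0 s t i p k * (j == q)%:R)
    + e 0 (inord 2) * (L0 s t i k p * (j == q)%:R)
    + e 0 (inord 3) * (L0 s t q j k * (i == p)%:R)
    + e 0 (inord 4) * (L0 s t q k j * (i == p)%:R) = 0.
  rewrite -[RHS](e0 (L0 s t) a0 (fun _ _ _ => 0) i j k) expr_evalE mulr0 add0r.
  rewrite (sumL _ (a0 ^~ j) p) ?(sumL _ (a0 ^~ j) p) ?(sumL _ (a0 i) q)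
    ?(sumL _ (a0 i) q) /a0 ?eqxx ?andbT //;
    by move=> al /negbTE ->; rewrite ?andbF mulr0.
have E1 : e 0 (inord 1) = 0.
  by have := key p q q q q;
    rewrite /L0 !eqxx ?pq ?qp /= !(mulr1n, mulr0, mul0r, mulr1, addr0, add0r).
have E2 : e 0 (inord 2) = 0.
  by have := key q p q q q;
    rewrite /L0 !eqxx ?pq ?qp /= !(mulr1n, mulr0, mul0r, mulr1, addr0, add0r).
have E3 : e 0 (inord 3) = 0.
  by have := key p q p p q;
    rewrite /L0 !eqxx ?pq ?qp /= !(mulr1n, mulr0, mul0r, mulr1, addr0, add0r).
have E4 : e 0 (inord 4) = 0.
  by have := key q p p p q;
    rewrite /L0 !eqxx ?pq ?qp /= !(mulr1n, mulr0, mul0r, mulr1, addr0, add0r).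
apply/rowP=> t; rewrite mxE -[t]inord_val.
case: t => -[|[|[|[|[|//]]]]] lt_t /=; rewrite ?E1 ?E2 ?E3 ?E4 //.
by rewrite -E0; congr (e 0 _); apply: val_inj; rewrite /= inordK.
Qed.

Section FieldDerivatives.
Variables (R : realType) (N : nat) (M : manifold R N).
Variables (L : connection M) (a : tensor11 M).

(* The covariant derivative of kind [c] in the chart [u], at the point with
   coordinates [x]. *)
Definition covariant_derivative (c : 'I_5) (u : chart M) (i j k : 'I_N)
    (x : 'rV[R]_N) : R :=
  covd (fun i j k => coef L u i j k x) (fun i j => component a u i j x)
       (fun i j k => partial k (component a u i j) x) c i j k.

End FieldDerivatives.

(* Main.v *)
Require Import Defs.
From mathcomp Require Import all_boot all_order all_algebra.
From mathcomp Require Import all_classical all_reals all_analysis.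
From mathcomp Require Import ring lra.
Import GRing.Theory Num.Theory.
Local Open Scope ring_scope.

(** Each derivative is the value, on the five formal terms, of a coefficient vector in R^5, so the
    question is one of linear algebra about five explicit vectors. They satisfy kind 1 + kind 2 =
    kind 3 + kind 4 = 2 (kind 0), which leaves rank three: kinds 1, 2, 3 are independent
    ([covd_expr123_free]) and yield the other two ([covd_expr_span123]). Evaluation is linear in the
    vector, so these relations pass to the tensor components with the same constants
    ([covd_linear_sum]). *)

Lemma expr_eval_linear_sum (R : realType) (N : nat)
    (L : 'I_N -> 'I_N -> 'I_N -> R) (a : 'I_N -> 'I_N -> R)
    (da : 'I_N -> 'I_N -> 'I_N -> R) (I : finType)
    (lam : I -> R) (e : I -> 'rV[R]_5) (i j k : 'I_N) :
  expr_eval L a da (\sum_p lam p *: e p) i j k =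
  \sum_p lam p * expr_eval L a da (e p) i j k.
Proof.
rewrite /expr_eval; under [RHS]eq_bigr do rewrite mulr_sumr.
rewrite exchange_big; apply: eq_bigr => t _ /=.
rewrite summxE mulr_suml; apply: eq_bigr => p _.
by rewrite mxE mulrA.
Qed.

Lemma covd_linear_sum (R : realType) (N : nat)
    (L : 'I_N -> 'I_N -> 'I_N -> R) (a : 'I_N -> 'I_N -> R)
    (da : 'I_N -> 'I_N -> 'I_N -> R) (I : finType)
    (lam : I -> R) (s : I -> 'I_5) (c : 'I_5) (i j k : 'I_N) :
  covd_expr R c = \sum_p lam p *: covd_expr R (s p) ->
  covd L a da c i j k = \sum_p lam p * covd L a da (s p) i j k.
Proof.
move=> ce; rewrite covd_exprE ce expr_eval_linear_sum.
by apply: eq_bigr => p _; rewrite covd_exprE.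
Qed.

(** The choice matters: kinds 0, 1, 2 are dependent, and so are kinds 0, 3, 4. *)
Definition kinds123 : 3.-tuple 'I_5 := [tuple inord 1; inord 2; inord 3].

(** Explicit coordinates reduce both independence and spanning to scalar equations in three
    unknowns. *)
Lemma covd_expr123E (R : realType) (lam : 'I_3 -> R) (t : 'I_5) :
  (\sum_p lam p *: covd_expr R (tnth kinds123 p)) 0 t =
  let: (x, y, z) := (lam 0, lam 1, lam (inord 2)) in
  nth 0 [:: x + y + z; x + z; y; - x; - y - z] t.
Proof.
(* [big_ord_recr] yields indices built from [ord_max] and [widen_ord]; here and below the two forms
   are matched. *)
have -> : inord 2 = ord_max :> 'I_3 by apply: val_inj; rewrite /= inordK.
rewrite summxE !big_ord_recr big_ord0 /= add0r !mxE /tnth /= !inordK //=.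
have -> : widen_ord (leqnSn 2) (widen_ord (leqnSn 1) ord_max) = 0.
  exact: val_inj.
have -> : widen_ord (leqnSn 2) ord_max = 1 by exact: val_inj.
by case: t => -[|[|[|[|[|//]]]]] lt_t /=; ring.
Qed.

Lemma covd_expr123_free (R : realType) :
  free [seq covd_expr R c | c <- kinds123].
Proof.
apply/(@freeP _ _ 3 (map_tuple (covd_expr R) kinds123)) => lam lam0.
have sum0 : \sum_p lam p *: covd_expr R (tnth kinds123 p) = 0.
  rewrite -[RHS]lam0; apply: eq_bigr => p _.
  by rewrite -(tnth_nth 0 (map_tuple _ _)) tnth_map.
have {sum0}coef0 t : (\sum_p lam p *: covd_expr R (tnth kinds123 p)) 0 t = 0.
  by rewrite sum0 mxE.
(* Entries 3, 2, 1 are -x, y and x + z, a triangular system that forces x = y = z = 0. *)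
have := coef0 (inord 1); have := coef0 (inord 2); have := coef0 (inord 3).
rewrite !covd_expr123E !inordK //= => /eqP; rewrite oppr_eq0 => /eqP x0 y0.
rewrite x0 add0r => z0 p; rewrite -[p]inord_val.
case: p => -[|[|[|//]]] lt_p //=.
  by rewrite -x0; congr (lam _); apply: val_inj; rewrite /= inordK.
by rewrite -y0; congr (lam _); apply: val_inj; rewrite /= inordK.
Qed.

(* Kind 0 is the mean of kinds 1 and 2, and kind 4 is kind 1 + kind 2 - kind 3. *)
Lemma covd_expr_span123 (R : realType) (c : 'I_5) : c \notin kinds123 ->
  exists lam : 'I_3 -> R,
    covd_expr R c = \sum_p lam p *: covd_expr R (tnth kinds123 p).
Proof.
rewrite !inE -!val_eqE /= !inordK // => c_notin.
exists (fun p : 'I_3 =>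
  nth 0 (if val c == 0%N then [:: 2^-1; 2^-1; 0] else [:: 1; 1; -1]) p).
apply/rowP => t; rewrite covd_expr123E mxE inordK //.
case: c c_notin => -[|[|[|[|[|//]]]]] lt_c //= _;
  by case: t => -[|[|[|[|[|//]]]]] lt_t /=; lra.
Qed.

Theorem theorem2p1 (R : realType) (N : nat) (M : manifold R N)
    (L : connection M) (a : tensor11 M) :
  exists T : 3.-tuple 'I_5,
    [/\ uniq T,
        free [seq covd_expr R c | c <- T] &
        forall c : 'I_5, c \notin T ->
          exists lam : 'I_3 -> R,
            covd_expr R c = \sum_(p < 3) lam p *: covd_expr R (tnth T p) /\
            forall (u : chart M) (x : M), dom u x ->
            forall i j k : 'I_N,
              covariant_derivative L a c u i j k (local_coord u x) =
              \sum_(p < 3) lam p *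
                covariant_derivative L a (tnth T p) u i j k (local_coord u x)].
Proof.
exists kinds123; split.
- by rewrite /= !inE -!val_eqE /= !inordK.
- exact: covd_expr123_free.
(* [lam] comes from the formal identity alone, so the same constants serve every chart, point and
   index. *)
- move=> c /(covd_expr_span123 R)[lam ce]; exists lam; split=> // u x _ i j k.
  exact: covd_linear_sum.
Qed.
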